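(* Let $(G,*,\mathbf e)$ be a hyper group with identity set $\mathbf e=\{e_\lambda:\lambda\in\Lambda\}$ indexed by a lattice $\Lambda$. For each $\lambda\in\Lambda$ set $G_\lambda:=\{x\in G: e_x=e_\lambda\}$. Then: (i) for each $\lambda\in\Lambda$, $(G_\lambda,* )$ is a group with identity $e_\lambda$; (ii) $G=\bigcup_{\lambda\in\Lambda}G_\lambda$ is a partition; (iii) if $x\in G_\lambda$ and $y\in G_\mu$, then $x*y\in G_{\lambda\vee\mu}$.
   Context: Hyper group: Let $(G,* )$ be a semigroup. A subset $\mathbf e\subset G$ is an identity set if (i) $g*e=e*g$ for all $g\in G$, $e\in\mathbf e$; (ii) $\mathbf e=\{e_\lambda:\lambda\in\Lambda\}$ is indexed without repetition by a lattice $(\Lambda,\le)$ and $e_\lambda*e_\mu=e_{\lambda\vee\mu}$; (iii) for each $g\in G$ there is a unique $e_g=e_{\lambda_g}\in\mathbf e$ such that for all $\lambda\in\Lambda$: $e_\lambda*g=g$ if and only if $\lambda\le\lambda_g$. A hyper group $(G,*,\mathbf e)$ is a semigroup with an identity set such that for each $g\in G$ there is $g^{-1}\in G$ (not assumed unique) with $g*g^{-1}=g^{-1}*g=e_g$. *)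

(* Defs.v *)
From HB Require Import structures.
From mathcomp Require Import all_boot all_order.
From mathcomp Require Import boolp classical_sets.

Set Implicit Arguments.
Unset Strict Implicit.
Unset Printing Implicit Defensive.

Local Open Scope classical_set_scope.
Local Open Scope group_scope.

(* The identity set is the range of [elt]; the indexing is by [L] and has no
   repetition. *)
Record identitySet (G : semigroupType) (d : Order.disp_t) (L : latticeType d) :=
  IdentitySet {
    elt :> L -> G;
    elt_inj : injective elt;
    elt_central : forall (g : G) (l : L), g * elt l = elt l * g;
    eltM : forall l m : L, elt l * elt m = elt (Order.join l m);
    elt_index : forall g : G,
      exists! lg : L, forall l : L, elt l * g = g <-> (l <= lg)%O }.

Section HyperGroup.
Context {G : semigroupType} {d : Order.disp_t} {L : latticeType d}.
Variable e : identitySet G L.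

(* [id_index g] is the index lambda_g, and [local_id g] the element e_g. *)
Definition id_index (g : G) : L := sval (cid (elt_index e g)).

Definition local_id (g : G) : G := e (id_index g).

Definition is_hyper_group : Prop :=
  forall g : G, exists h : G, g * h = local_id g /\ h * g = local_id g.

Definition component (l : L) : set G := [set x | local_id x = e l].

End HyperGroup.

Record is_group_on (T : Type) (op : T -> T -> T) (A : set T) (u : T) : Prop :=
  IsGroupOn {
    group_on_closed : forall x y, A x -> A y -> A (op x y);
    group_on_assoc : forall x y z, A x -> A y -> A z ->
      op x (op y z) = op (op x y) z;
    group_on_id : A u;
    group_on_idl : forall x, A x -> op u x = x;
    group_on_idr : forall x, A x -> op x u = x;
    group_on_inv : forall x, A x ->
      exists y, [/\ A y, op x y = u & op y x = u] }.

(* Main.v *)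
Require Import Defs.
From HB Require Import structures.
From mathcomp Require Import all_boot all_order.
From mathcomp Require Import boolp classical_sets.

Import Order.LTheory.

(** Everything follows from two facts about the index map [id_index]: it sends
    [e l] to [l] ([id_index_elt]), and it turns products into joins
    ([id_index_mul]).  The second one holds because inverses reduce any equation
    [e k * (x * y) = x * y] to the same equation between identities, where it
    only speaks of the lattice order.  As [component e l] is the fibre of
    [id_index] over [l], the components partition the semigroup, are nonempty,
    and multiply along joins; idempotence of the join closes each of them under
    products.  A given inverse of [x] may lie in a lower component, but
    multiplying it by [e l] moves it into the component of [x]
    ([component_inv]). *)

Set Implicit Arguments.
Unset Strict Implicit.
Unset Printing Implicit Defensive.

Local Open Scope classical_set_scope.
Local Open Scope group_scope.

Section IndexMap.
Context {G : semigroupType} {d : Order.disp_t} {L : latticeType d}.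
Variable e : identitySet G L.

Lemma id_indexP (g : G) (l : L) : e l * g = g <-> (l <= id_index e g)%O.
Proof. by rewrite /id_index; case: cid => lg [/= Hlg _]; apply: Hlg. Qed.

Lemma id_index_unique (g : G) (m : L) :
  (forall l : L, e l * g = g <-> (l <= m)%O) -> id_index e g = m.
Proof.
move=> Hm; apply/le_anti/andP; split.
  by apply/Hm/id_indexP.
by apply/id_indexP/Hm.
Qed.

Lemma elt_absorb (k l : L) : e k * e l = e l <-> (k <= l)%O.
Proof.
rewrite eltM; split=> [/elt_inj <-|]; first exact: leUl.
by move/join_r ->.
Qed.

Lemma id_index_elt (l : L) : id_index e (e l) = l.
Proof. by apply: id_index_unique => k; apply: elt_absorb. Qed.

Lemma componentE (l : L) (x : G) : component e l x <-> id_index e x = l.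
Proof. by split=> [/elt_inj|<-]. Qed.

Lemma local_id_mul (x : G) : local_id e x * x = x.
Proof. exact/id_indexP/lexx. Qed.

Hypothesis hG : is_hyper_group e.

(** If [e k] fixes [x * y], multiplying by an inverse of [x] on the left and of
    [y] on the right shows that [e k], being central, absorbs the product of the
    local identities of [x] and [y]; conversely that product fixes [x * y]. *)
Lemma id_index_mul (x y : G) :
  id_index e (x * y) = Order.join (id_index e x) (id_index e y).
Proof.
have fix_xy : local_id e x * local_id e y * (x * y) = x * y.
  rewrite -mulgA (mulgA (local_id e y)) -(elt_central e x) -mulgA.
  by rewrite local_id_mul mulgA local_id_mul.
apply: id_index_unique => k; rewrite -elt_absorb -eltM.
split=> [ek|ek]; last by rewrite -fix_xy mulgA ek.
have [x' [_ x'x]] := hG x; have [y' [yy' _]] := hG y.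
have -> : e (id_index e x) * e (id_index e y) = x' * (x * y) * y'.
  by rewrite -/(local_id e x) -/(local_id e y) -x'x -yy' !mulgA.
by rewrite !(mulgA (e k)) -elt_central -(mulgA x') ek.
Qed.

(** Since [x * h = e l], the index of [h] joined with [l] is [l], so that
    [e l * h] has index exactly [l]; it is still inverse to [x] because [e l]
    is central and idempotent. *)
Lemma component_inv (l : L) (x : G) : component e l x ->
  exists y, [/\ component e l y, x * y = e l & y * x = e l].
Proof.
move=> xl; have [h [xh hx]] := hG x; rewrite xl in xh hx.
have el2 : e l * e l = e l by rewrite elt_absorb lexx.
exists (e l * h); split.
- have /componentE <- := xl; apply/componentE.
  rewrite id_index_mul id_index_elt -id_index_mul xh id_index_elt.
  by have /componentE := xl.
- by rewrite mulgA elt_central -mulgA xh.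
- by rewrite -mulgA hx.
Qed.

End IndexMap.

Theorem proposition3p11 (G : semigroupType) (d : Order.disp_t)
    (L : latticeType d) (e : identitySet G L) (hG : is_hyper_group e) :
  [/\ forall l : L, is_group_on (fun x y : G => x * y) (component e l) (e l),
      partition [set: L] (component e) [set: G]
    & forall (l m : L) (x y : G), component e l x -> component e m y ->
        component e (Order.join l m) (x * y)].
Proof.
have mul_comp (l m : L) (x y : G) : component e l x -> component e m y ->
    component e (Order.join l m) (x * y).
  by move=> /componentE <- /componentE <-; apply/componentE/id_index_mul.
have elt_comp (l : L) : component e l (e l) by apply/componentE/id_index_elt.
split=> // [l|].
  have idl (x : G) : component e l x -> e l * x = x.
    by move=> <-; apply: local_id_mul.
  split=> //.
  - by move=> x y xl yl; rewrite -(joinxx l); apply: mul_comp.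
  - by move=> x y z _ _ _; rewrite mulgA.
  - by move=> x xl; rewrite elt_central idl.
  - by move=> x; apply: component_inv.
split.
- by apply/seteqP; split=> // x _; exists (id_index e x).
- by move=> l m _ _ [x [/componentE <- /componentE <-]].
- by move=> l _; exists (e l).
Qed.
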